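(* Let $\mathcal{X}$ be a separable locally convex $\mathbb{R}$-vector space (Hausdorff) and $\mathcal{X}^{+}\subseteq\mathcal{X}$ a convex cone. Assume that for every $0$-neighborhood $\mathcal{U}$ there are $A_1,A_2\in\mathcal{X}$ and a $0$-neighborhood $\tilde{\mathcal{U}}$ with $\tilde{\mathcal{U}}\subseteq[A_1,A_2]\subseteq\mathcal{U}$. Then for every $0$-neighborhood $\mathcal{U}$ satisfying the infinite-dimensionality condition and every $U\in\mathbf{CU}_{\mathcal{U}}(\mathcal{X}^{\ast,+})$, there are a $0$-neighborhood $\tilde{\mathcal{U}}\subseteq\mathcal{U}$ and a sequence $(U_n)_{n\in\mathbb{N}}\subseteq\mathcal{D}^{+}_{0,\tilde{\mathcal{U}}}$ converging to $U$ in the weak*-Hausdorff hypertopology.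
   Context: $\mathcal{X}^{\ast}$ is the topological dual with the weak* topology. A convex cone is a set $\mathcal{X}^+$ with $\lambda A\in\mathcal{X}^+$ and $A+B\in\mathcal{X}^+$ for $\lambda>0$, $A,B\in\mathcal{X}^+$; it induces the preorder $A\preceq B$ iff $B-A\in\mathcal{X}^+$, and intervals $[A_1,A_2]=\{A:A_1\preceq A\preceq A_2\}$. $\mathcal{X}^{\ast,+}=\{\sigma\in\mathcal{X}^{\ast}:\sigma(A)\ge0\ \forall A\in\mathcal{X}^+\}$. A $0$-neighborhood $\mathcal{U}$ satisfies the infinite-dimensionality condition if there is an infinite set $\{\sigma_n\}$ of linearly independent elements of $\mathcal{X}^{\ast}$ with $\sup_{A\in\mathcal{U}}|\sigma_n(A)|<\infty$ for every $n$. $\mathcal{U}^{\circ}=\{\sigma\in\mathcal{X}^{\ast}:|\sigma(A)|\le1\ \forall A\in\mathcal{U}\}$; $\mathbf{CU}_{\mathcal{U}}(\mathcal{X}^{\ast})$ is the set of nonempty convex weak*-closed subsets of $\mathcal{U}^{\circ}$; $\mathbf{CU}_{\mathcal{U}}(\mathcal{X}^{\ast,+})=\{U\in\mathbf{CU}_{\mathcal{U}}(\mathcal{X}^{\ast}):U\subseteq\mathcal{X}^{\ast,+}\}$. A point $\sigma_0$ of a convex $C\subseteq\mathcal{X}^{\ast}$ is exposed if some $A\in\mathcal{X}$ makes $\sigma\mapsto\sigma(A)$ attain its maximum on $C$ uniquely at $\sigma_0$; $\mathcal{E}_0(C)$ is the set of exposed points. $\mathcal{D}_{0,\mathcal{U}}=\{U\in\mathbf{CU}_{\mathcal{U}}(\mathcal{X}^{\ast}):U=\overline{\mathcal{E}_0(U)}\}$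 and $\mathcal{D}^{+}_{0,\mathcal{U}}=\mathcal{D}_{0,\mathcal{U}}\cap\mathbf{CU}_{\mathcal{U}}(\mathcal{X}^{\ast,+})$. The weak*-Hausdorff hypertopology is generated by the extended pseudometrics $d_H^{(A)}(F,\tilde F)=\max\{\sup_{\sigma\in F}\inf_{\tilde\sigma\in\tilde F}|(\sigma-\tilde\sigma)(A)|,\ \sup_{\tilde\sigma\in\tilde F}\inf_{\sigma\in F}|(\sigma-\tilde\sigma)(A)|\}$, $A\in\mathcal{X}$. *)

(* Defs.v *)
From HB Require Import structures.
From mathcomp Require Import all_boot all_order all_algebra.
From mathcomp Require Import all_classical all_reals all_analysis.
Set Implicit Arguments. Unset Strict Implicit. Unset Printing Implicit Defensive.
Import Order.TTheory GRing.Theory Num.Theory.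
Local Open Scope classical_set_scope.
Local Open Scope ring_scope.

Section Defs.
Variables (R : realType) (X : tvsType R).

Definition in_dual (s : X -> R) : Prop :=
  (forall (a : R) (x y : X), s (a *: x + y) = a * s x + s y) /\ continuous (s : X -> R^o).

Definition convex_cone (Xp : set X) : Prop :=
  (forall (l : R) (A : X), 0 < l -> Xp A -> Xp (l *: A)) /\
  (forall A B : X, Xp A -> Xp B -> Xp (A + B)).

Definition cone_le (Xp : set X) (A B : X) : Prop := Xp (B - A).
Definition cone_interval (Xp : set X) (A1 A2 : X) : set X :=
  [set A | cone_le Xp A1 A /\ cone_le Xp A A2].

Definition dual_pos (Xp : set X) : set (X -> R) :=
  [set s | in_dual s /\ forall A, Xp A -> 0 <= s A].

Definition polar (U : set X) : set (X -> R) :=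
  [set s | in_dual s /\ forall A, U A -> `|s A| <= 1].

Definition infdim_cond (U : set X) : Prop :=
  exists s : nat -> (X -> R),
    (forall n, in_dual (s n)) /\
    (forall (n : nat) (c : nat -> R),
        (forall x, \sum_(i < n) c i * s i x = 0) -> forall i, (i < n)%N -> c i = 0) /\
    (forall n, exists M : R, forall A, U A -> `|s n A| <= M).

(* weak*-closure inside X^dual : sigma is in the closure of C iff every basic
   weak* neighbourhood {tau | |tau A - sigma A| < eps, A in F} meets C. *)
Definition wstar_closure (C : set (X -> R)) : set (X -> R) :=
  [set s | in_dual s /\
     forall (F : seq X) (eps : R), 0 < eps ->
       exists2 t, C t & forall A, A \in F -> `|t A - s A| < eps].

Definition wstar_closed (C : set (X -> R)) : Prop := wstar_closure C `<=` C.

Definition convex_fun_set (C : set (X -> R)) : Prop :=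
  forall s t (l : R), C s -> C t -> 0 <= l <= 1 ->
    C (fun A => l * s A + (1 - l) * t A).

Definition CU (U : set X) : set (set (X -> R)) :=
  [set C | C !=set0 /\ convex_fun_set C /\ wstar_closed C /\ C `<=` polar U].

Definition CU_pos (Xp : set X) (U : set X) : set (set (X -> R)) :=
  [set C | CU U C /\ C `<=` dual_pos Xp].

Definition exposed_points (C : set (X -> R)) : set (X -> R) :=
  [set s0 | C s0 /\ exists A : X, forall s, C s -> s <> s0 -> s A < s0 A].

Definition D0 (U : set X) : set (set (X -> R)) :=
  [set C | CU U C /\ C = wstar_closure (exposed_points C)].

Definition D0_pos (Xp : set X) (U : set X) : set (set (X -> R)) :=
  D0 U `&` CU_pos Xp U.

Definition dH (A : X) (F G : set (X -> R)) : \bar R :=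
  maxe
    (ereal_sup [set ereal_inf [set (`|s A - t A|)%:E | t in G] | s in F])
    (ereal_sup [set ereal_inf [set (`|s A - t A|)%:E | s in F] | t in G]).

(* convergence in the weak*-Hausdorff hypertopology generated by the dH A *)
Definition hausdorff_cvg (Un : nat -> set (X -> R)) (U : set (X -> R)) : Prop :=
  forall A : X, (fun n => dH A (Un n) U) @ \oo --> 0%E.

End Defs.

(* Main.v *)
(* The pseudometric d_H^(A) only sees the interval { s(A) : s in C }, so convergence
   amounts to approximating support functions.  By separability, countably many
   points p_i of C attain the supremum of every A in X up to any error, and it suffices to
   approximate the polytopes with vertices p_0, .., p_n.

   Every functional is dominated on the cone by a positive one (Hahn-Banach, from
   the order intervals that are 0-neighborhoods).  Complete a basis sig_0, .., sig_(m-1)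
   of span(p_0, .., p_n) to an infinite biorthogonal system (sig_k, a_k); for
   k >= m rescale sig_k so that it is tiny on a 0-neighborhood, and let om be a
   small positive functional dominating the sum of a large multiple of these sig_k.
   The approximant is the set of all
     om + sum_k x_k sig_k   with   sum_(k < m) x_k sig_k in C,   sum_k x_k^2 <= M.
   Its finitely supported points on the sphere sum_k x_k^2 = M are exposed by
   sum_k x_k a_k, and they are weak* dense: truncating a point and restoring
   its norm with a remote coordinate x_N hardly moves it, as sig_N -> 0. *)
Require Import Defs.
From HB Require Import structures.
From mathcomp Require Import all_boot all_order all_algebra.
From mathcomp Require Import all_classical all_reals all_analysis.
From mathcomp Require Import ring lra.
Set Implicit Arguments. Unset Strict Implicit. Unset Printing Implicit Defensive.
Import Order.TTheory GRing.Theory Num.Theory.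
Local Open Scope classical_set_scope.
Local Open Scope ring_scope.

(** * Hahn-Banach *)

Section HahnBanach.
Variables (R : realType) (V : lmodType R).

(** Inequalities suffice and pass directly to infima; [sublinearZ] recovers equality. *)
Definition sublinear (p : V -> R) :=
  [/\ forall x y, p (x + y) <= p x + p y, p 0 <= 0 &
      forall (r : R) x, 0 < r -> p (r *: x) <= r * p x].

Lemma sublinearZ p r x : sublinear p -> 0 <= r -> p (r *: x) = r * p x.
Proof.
case=> pD p0 pZ; rewrite le_eqVlt => /predU1P[<-|r0].
  rewrite scale0r mul0r; apply/eqP; rewrite eq_le p0.
  by have := pD 0 0; rewrite addr0; lra.
apply/eqP; rewrite eq_le pZ//=.
have := pZ r^-1 (r *: x); rewrite invr_gt0 => /(_ r0).
by rewrite scalerA mulVf ?gt_eqF// scale1r mulrC ler_pdivlMr// mulrC.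
Qed.

Lemma sublinear_lb p x : sublinear p -> - p (- x) <= p x.
Proof.
move=> sp; have [pD _ _] := sp; have := pD x (- x).
by rewrite subrr -(scale0r (0 : V)) sublinearZ// mul0r; lra.
Qed.

(** Serves three times: for the directional infimum of the next lemma, for the infimum of a chain,
    and for the functional of [dual_dominated]. *)
Lemma sublinear_inf (E : V -> set R) :
  (forall x, E x !=set0) -> (forall x, has_lbound (E x)) ->
  (forall x y u v, E x u -> E y v -> exists2 w, E (x + y) w & w <= u + v) ->
  (exists2 u, E 0 u & u <= 0) ->
  (forall r x u, 0 < r -> E x u -> exists2 w, E (r *: x) w & w <= r * u) ->
  sublinear (fun x => inf (E x)).
Proof.
move=> E0 lb ED [u Eu u0] EZ; split.
- move=> x y; rewrite -lerBlDr; apply: lb_le_inf => // v Ev.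
  rewrite lerBlDr -lerBlDl; apply: lb_le_inf => // w Ew.
  rewrite lerBlDl; have [z Ez] := ED _ _ _ _ Ev Ew.
  exact/le_trans/ge_inf.
- by apply: le_trans u0; exact: ge_inf.
- move=> r x r0; rewrite mulrC -ler_pdivrMr//; apply: lb_le_inf => // v Ev.
  rewrite ler_pdivrMr// mulrC; have [w Ew] := EZ _ _ _ r0 Ev.
  exact/le_trans/ge_inf.
Qed.

(* For fixed y, the infimum over t >= 0 of p (z + t y) - t p(y) is sublinear in z
   and below p, hence equal to p: this forces additivity. *)
Lemma minimal_sublinear_linear p : sublinear p ->
  (forall q, sublinear q -> (forall x, q x <= p x) -> q = p) ->
  forall (a : R) x y, p (a *: x + y) = a * p x + p y.
Proof.
move=> sp minp; have [pD p0 pZ] := sp.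
have pZE r x : 0 <= r -> p (r *: x) = r * p x by apply: sublinearZ.
have pDE x y : p (x + y) = p x + p y.
  pose E z := [set p (z + t *: y) - t * p y | t in [set t : R | 0 <= t]].
  have Ep z : E z (p z) by exists 0 => //=; rewrite scale0r mul0r subr0 addr0.
  have lb z : has_lbound (E z).
    exists (- p (- z)) => _ [t /= t0 <-]; rewrite -pZE//.
    have := pD (z + t *: y) (- z); rewrite addrAC subrr add0r; lra.
  have sq : sublinear (fun z => inf (E z)).
    apply: sublinear_inf => //; first by move=> z; exists (p z).
    - move=> z w _ _ [t /= t0 <-] [u /= u0 <-].
      exists (p (z + w + (t + u) *: y) - (t + u) * p y).
        by exists (t + u) => //=; rewrite addr_ge0.
      by have := pD (z + t *: y) (w + u *: y); rewrite scalerDl addrACA; lra.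
    - by exists (p 0).
    - move=> r z _ r0 [t /= t0 <-].
      exists (p (r *: z + (r * t) *: y) - r * t * p y).
        by exists (r * t) => //=; rewrite mulr_ge0// ltW.
      by rewrite -scalerA -scalerDr pZE ?(ltW r0)// mulrBr mulrA.
  have qp : (fun z => inf (E z)) = p by apply: minp => // z; exact: ge_inf.
  apply/eqP; rewrite eq_le pD/= -lerBrDr.
  rewrite -[X in X <= _](congr1 (@^~ x) qp); apply: ge_inf => //.
  by exists 1; rewrite /= ?ler01// scale1r mul1r.
have pN x : p (- x) = - p x.
  have := pDE x (- x); rewrite subrr -(scale0r (0 : V)) pZE// mul0r; lra.
move=> a x y; rewrite pDE; congr (_ + _).
have [a0|a0] := leP 0 a; first exact: pZE.
by rewrite -[a *: x]opprK -scaleNr pN pZE ?mulNr ?opprK// oppr_ge0 ltW.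
Qed.

(** Zorn yields a minimal sublinear functional below [p], and minimality forces linearity; nothing
    is extended from subspaces. *)
Lemma hahn_banach p : sublinear p ->
  exists2 f : V -> R, (forall (a : R) x y, f (a *: x + y) = a * f x + f y) &
    forall x, f x <= p x.
Proof.
move=> sp.
pose T := {q : V -> R | sublinear q /\ forall x, q x <= p x}.
(* The order is reversed, so that a maximal element is a minimal functional. *)
pose le (s t : T) := `[< forall x, sval t x <= sval s x >].
have [] := @Zorn T le.
- by move=> t; apply/asboolP.
- move=> r s t /asboolP rs /asboolP st; apply/asboolP => x.
  exact: le_trans (rs x).
- move=> [s hs] [t ht] /asboolP/= st /asboolP/= ts; apply: eq_exist.
  by apply/funext => x; apply/eqP; rewrite eq_le st ts.
- move=> A Atot; have [[s0 As0]|/nonemptyPn A0] := pselect (A !=set0); last first.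
    have spp : sublinear p /\ forall x, p x <= p x by [].
    by exists (exist (fun q => sublinear q /\ forall x, q x <= p x) p spp) => s; rewrite A0.
  pose E x := [set sval s x | s in A].
  have lb x : has_lbound (E x).
    exists (- p (- x)) => _ [[s /= [ss sp']] As <-].
    by apply: le_trans (sublinear_lb x ss); rewrite lerN2.
  have infle x s : A s -> inf (E x) <= sval s x.
    by move=> As; apply: ge_inf => //; exists s.
  have st : sublinear (fun x => inf (E x)) /\ forall x, inf (E x) <= p x.
    split; last first.
      by move=> x; apply: le_trans (infle _ _ As0) _; case: (svalP s0).
    apply: sublinear_inf => //; first by move=> x; exists (sval s0 x), s0.
    - move=> x y _ _ [i Ai <-] [j Aj <-].
      have [/asboolP ij|/asboolP ji] := Atot _ _ Ai Aj.
        exists (sval j (x + y)); first by exists j.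
        have [[h _ _] _] := svalP j.
        by apply: le_trans (h x y) _; rewrite lerD2r; exact: ij.
      exists (sval i (x + y)); first by exists i.
      have [[h _ _] _] := svalP i.
      by apply: le_trans (h x y) _; rewrite lerD2l; exact: ji.
    - by exists (sval s0 0); [exists s0|case: (svalP s0) => -[]].
    - move=> r x _ r0 [i Ai <-]; exists (sval i (r *: x)); first by exists i.
      by case: (svalP i) => -[_ _ h] _; exact: h.
  exists (exist (fun q => sublinear q /\ forall x, q x <= p x) _ st) => s As.
  by apply/asboolP => x; exact: infle.
move=> t mint; have [st tp] := svalP t.
exists (sval t) => //; apply: minimal_sublinear_linear => // q sq qt.
have sqp : sublinear q /\ forall x, q x <= p x.
  by split => // x; apply: le_trans (tp x).
have := mint (exist (fun q => sublinear q /\ forall x, q x <= p x) q sqp).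
move=> /(_ _)/(congr1 sval)/= -> //.
by apply/asboolP.
Qed.

End HahnBanach.

(** * Continuous linear forms *)

Section LinearForms.
Variables (R : realType) (V : lmodType R) (s : V -> R).
Hypothesis sL : forall (a : R) x y, s (a *: x + y) = a * s x + s y.

Lemma linfD x y : s (x + y) = s x + s y.
Proof. by rewrite -[x]scale1r sL mul1r scale1r. Qed.

Lemma linf0 : s 0 = 0.
Proof. by have := linfD 0 0; rewrite addr0; lra. Qed.

Lemma linfZ a x : s (a *: x) = a * s x.
Proof. by rewrite -[a *: x]addr0 sL linf0 addr0. Qed.

Lemma linfN x : s (- x) = - s x.
Proof. by rewrite -scaleN1r linfZ mulN1r. Qed.

Lemma linfB x y : s (x - y) = s x - s y.
Proof. by rewrite linfD linfN. Qed.

Lemma linf_sum n (c : 'I_n -> R) (v : 'I_n -> V) :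
  s (\sum_i c i *: v i) = \sum_i c i * s (v i).
Proof.
elim/big_rec2: _ => [|i x y _ <-]; first exact: linf0.
exact: sL.
Qed.

End LinearForms.

Section Dual.
Variables (R : realType) (X : tvsType R).
Implicit Types (s t : X -> R) (W : set X).

Lemma nbhs0_scale_near W (x : X) : nbhs 0 W ->
  \forall e \near (0 : R^o), W (e *: x).
Proof.
move=> W0; have := @scale_continuous R X (0, x); rewrite /= /continuous_at/=.
rewrite scale0r => /(_ W W0)[[P Q] /= [P0 Qx] PQ].
near=> e; apply: (PQ (e, x)); split => /=; first by near: e.
exact: nbhs_singleton.
Unshelve. all: by end_near. Qed.

Lemma nbhs0_absorb W (x : X) : nbhs 0 W -> exists2 e : R, 0 < e & W (e *: x).
Proof.
move=> /(@nbhs0_scale_near W x)/nbhs_ballP[e /= e0 he].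
exists (e / 2); first by rewrite divr_gt0.
apply: he; rewrite /ball/= sub0r normrN gtr0_norm ?divr_gt0//.
by rewrite gtr_pMr ?invf_lt1 ?ltr1n.
Qed.

(** [W] absorbs [x] at a scale depending on neither the form nor its bound, so estimates on [W]
    transfer to [x] uniformly. *)
Lemma linf_gauge W (x : X) : nbhs 0 W ->
  exists2 k : R, 0 < k & forall s c,
    (forall (a : R) x y, s (a *: x + y) = a * s x + s y) ->
    (forall y, W y -> `|s y| <= c) -> `|s x| <= k * c.
Proof.
move=> /(nbhs0_absorb x)[e e0 We]; exists e^-1; first by rewrite invr_gt0.
move=> s c sL sc; rewrite mulrC ler_pdivlMr// mulrC -(gtr0_norm e0) -normrM.
by rewrite -linfZ//; exact: sc.
Qed.

Lemma linf_bounded_dual W s c : nbhs 0 W ->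
  (forall (a : R) x y, s (a *: x + y) = a * s x + s y) ->
  (forall y, W y -> `|s y| <= c) -> in_dual s.
Proof.
move=> W0 sL sc; split => // x; apply/cvgrPdist_le => /= e e0.
have c0 : 0 <= c by apply: le_trans (sc 0 (nbhs_singleton W0)).
have r0 : e / (c + 1) != 0 :> R by rewrite mulf_neq0 ?gt_eqF ?invr_gt0 ?ltr_wpDl.
have := nbhsT x (nbhs0Z r0 W0); apply: filterS => _ [_ [y Wy <-] <-].
rewrite /= -linfB// opprD addrA subrr add0r linfN// normrN linfZ// normrM gtr0_norm; last first.
  by rewrite divr_gt0// ltr_wpDl.
rewrite mulrAC ler_pdivrMr ?ltr_wpDl//; apply: ler_wpM2l; first exact: ltW.
by apply: le_trans (sc _ Wy) _; rewrite lerDl.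
Qed.

Lemma dual_bounded s : in_dual s -> nbhs 0 [set x | `|s x| <= 1].
Proof.
case=> sL /(_ 0) /cvgrPdist_le /(_ 1 ltr01).
apply: filterS => x /=; by rewrite linf0// sub0r normrN.
Qed.

Lemma dual_comb (a : R) s t : in_dual s -> in_dual t ->
  in_dual (fun x => a * s x + t x).
Proof.
move=> ds dt; have [sL _] := ds; have [tL _] := dt.
apply: (linf_bounded_dual (c := `|a| + 1)).
- exact: filterI (dual_bounded ds) (dual_bounded dt).
- by move=> b x y; rewrite sL tL; ring.
- move=> y [/= sy ty]; apply: le_trans (ler_normD _ _) _.
  by rewrite normrM lerD// ler_piMr.
Qed.

Lemma dual0 : in_dual (fun _ : X => 0 : R).
Proof.
apply: (linf_bounded_dual (c := 0) (W := setT)); first exact: filterT.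
  by move=> *; rewrite mulr0 addr0.
by move=> *; rewrite normr0.
Qed.

Lemma dualZ (a : R) s : in_dual s -> in_dual (fun x => a * s x).
Proof.
move=> ds; have := dual_comb a ds dual0.
by under eq_fun do rewrite addr0.
Qed.

Lemma dualD s t : in_dual s -> in_dual t -> in_dual (fun x => s x + t x).
Proof.
move=> ds dt; have := dual_comb 1 ds dt.
by under eq_fun do rewrite mul1r.
Qed.

Lemma dualB s t : in_dual s -> in_dual t -> in_dual (fun x => s x - t x).
Proof.
move=> ds dt; have := dual_comb (-1) dt ds.
by under eq_fun do rewrite mulN1r addrC.
Qed.

Lemma dual_sum n (sig : nat -> X -> R) (y : nat -> R) :
  (forall k, (k < n)%N -> in_dual (sig k)) ->
  in_dual (fun x => \sum_(k < n) y k * sig k x).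
Proof.
elim: n => [|n IH] h.
  by under eq_fun do rewrite big_ord0; exact: dual0.
under eq_fun do rewrite big_ord_recr/= addrC.
by apply: dual_comb; [exact: h|apply: IH => k kn; apply: h; exact: ltnW].
Qed.

Lemma dual_pos_bounded Xp A1 A2 s x : dual_pos Xp s ->
  cone_interval Xp A1 A2 x -> `|s x| <= `|s A1| + `|s A2|.
Proof.
move=> [[sL _] sp] [/sp + /sp]; rewrite !linfB// => h1 h2.
have := ler_norm (s A2); have := ler_norm (- s A1); rewrite normrN ler_norml.
by have := normr_ge0 (s A1); have := normr_ge0 (s A2) => *; apply/andP; split; lra.
Qed.

(* With e = A2 - A1 and c = 1 + |s A1|, a linear f below
   q(x) = inf { l c - s B : l >= 0, B >= 0, x + B <= l e } satisfies f >= 0 and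
   f >= s on the cone, so that 2 f - s works. *)
Lemma dual_dominated Xp s : convex_cone Xp -> in_dual s ->
  (exists (A1 A2 : X) W, [/\ nbhs 0 W, W `<=` cone_interval Xp A1 A2 &
     forall x, cone_interval Xp A1 A2 x -> `|s x| <= 1]) ->
  exists2 g, dual_pos Xp g & forall x, Xp x -> `|s x| <= g x.
Proof.
move=> [XZ XD] ds [A1 [A2 [W [W0 Wi si]]]]; have [sL _] := ds.
pose e := A2 - A1; pose c := 1 + `|s A1|.
(* A convex cone need not contain 0; adjoining it allows [B = 0] and equality in the constraints of
   the infimum. *)
pose P := [set x : X | x = 0 \/ Xp x].
have PD x y : P x -> P y -> P (x + y).
  by move=> [->|px] [->|py]; rewrite ?addr0 ?add0r; [left|right|right|right; exact: XD].
have PXD x y : P x -> Xp y -> Xp (x + y) by move=> [->|px] py; rewrite ?add0r//; exact: XD.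
have PZ r x : 0 < r -> P x -> P (r *: x).
  by move=> r0 [->|px]; [left; rewrite scaler0|right; exact: XZ].
have nA1 : Xp (- A1) by have [] := Wi 0 (nbhs_singleton W0); rewrite /cone_le sub0r.
(* [A1] is below 0, so [A2] is below [e]; as [W] absorbs [x], this makes [e] an order unit. *)
have absorb x : exists2 l : R, 0 < l & Xp (l *: e - x).
  have [t t0 /Wi[_ wt]] := nbhs0_absorb x W0.
  exists t^-1; rewrite ?invr_gt0//.
  have -> : t^-1 *: e - x = t^-1 *: (A2 - t *: x) + t^-1 *: (- A1).
    by rewrite !scalerBr scalerN scalerA mulVf ?gt_eqF// scale1r addrAC.
  by apply: XD; apply: XZ; rewrite ?invr_gt0.
pose E x := [set z | exists (l : R) B,
  [/\ 0 <= l, P B, P (l *: e - x - B) & z = l * c - s B]].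
have lbE x : has_lbound (E x).
  have [m m0 mx] := absorb (- x).
  exists (- (m * c)) => _ [l [B [l0 PB PxB ->]]].
  have nu0 : 0 < l + m by rewrite ltr_wpDl.
  suff : s B <= (l + m) * c by lra.
  have c0 : 0 < c by rewrite ltr_pwDl.
  case: PB PxB => [-> _|XB PxB]; first by rewrite (linf0 sL)// mulr_ge0// ltW.
  (* Adding the bounds of [x + B] by [l *: e] and of [- x] by [m *: e] puts [B] below
     [(l + m) *: e]; on the interval [s] is at most 1. *)
  have : cone_interval Xp A1 A2 (A1 + (l + m)^-1 *: B).
    split; rewrite /cone_le.
      by rewrite addrAC subrr add0r; apply: XZ; rewrite ?invr_gt0.
    have -> : A2 - (A1 + (l + m)^-1 *: B) = (l + m)^-1 *: ((l *: e - x - B) + (m *: e - - x)).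
      rewrite (_ : l *: e - x - B + (m *: e - - x) = (l + m) *: e - B); last first.
        by rewrite opprK scalerDl [m *: e + x]addrC addrA [l *: e - x - B]addrAC addrNK addrAC.
      by rewrite scalerBr scalerA mulVf ?gt_eqF// scale1r /e opprD addrA.
    by apply: XZ; rewrite ?invr_gt0//; exact: PXD.
  move=> /si; rewrite (linfD sL)// (linfZ sL)// => h.
  rewrite mulrC -ler_pdivrMr// mulrC /c.
  have := ler_norm (s A1 + (l + m)^-1 * s B); have := ler_norm (- s A1).
  rewrite normrN; lra.
have sq : sublinear (fun x => inf (E x)).
  apply: sublinear_inf.
  - move=> x; have [l l0 lx] := absorb x.
    exists (l * c - s 0), l, 0; split => //; [exact: ltW|by left|].
    by right; rewrite subr0.
  - exact: lbE.
  - move=> x y _ _ [l [B [l0 PB h ->]]] [l' [B' [l0' PB' h' ->]]].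
    exists ((l + l') * c - s (B + B')); last by rewrite (linfD sL); lra.
    exists (l + l'), (B + B'); split => //; [by rewrite addr_ge0|exact: PD|].
    have := PD _ _ h h'; congr P.
    by rewrite scalerDl !opprD addrACA [in X in X + _]addrACA.
  - exists (0 * c - s 0); last by rewrite mul0r (linf0 sL)// subr0.
    exists 0, 0; split => //; first by left.
    by left; rewrite scale0r !subr0.
  - move=> r x _ r0 [l [B [l0 PB h ->]]].
    exists (r * l * c - s (r *: B)); last by rewrite (linfZ sL)//; lra.
    exists (r * l), (r *: B); split => //; [by rewrite mulr_ge0// ltW|exact: PZ|].
    by rewrite -scalerA -!scalerBr; exact: PZ.
have [f fL fq] := hahn_banach sq.
(* Positivity comes from the choice [l = 0], [B = 0] at [- x]; domination of [s] from [l = 0],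
   [B = x]. *)
have fp x : Xp x -> 0 <= f x.
  move=> px; suff : f (- x) <= 0 by rewrite (linfN fL) oppr_le0.
  apply: le_trans (fq _) _; apply: ge_inf => //.
  exists 0, 0; split => //; first by left.
    by right; rewrite scale0r subr0 sub0r opprK.
  by rewrite mul0r (linf0 sL)// subr0.
have fs x : Xp x -> s x <= f x.
  move=> px; suff : f (- x) <= - s x by rewrite (linfN fL) lerN2.
  apply: le_trans (fq _) _; apply: ge_inf => //.
  exists 0, x; split => //; first by right.
    by left; rewrite scale0r sub0r opprK subrr.
  by rewrite mul0r sub0r.
have gL (a : R) x y : 2 * f (a *: x + y) - s (a *: x + y) =
    a * (2 * f x - s x) + (2 * f y - s y) by rewrite fL sL; ring.
have gs x : Xp x -> `|s x| <= 2 * f x - s x.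
  by move=> px; have := fp x px; have := fs x px; rewrite ler_norml => *; apply/andP; split; lra.
exists (fun x => 2 * f x - s x) => //.
have gp x : Xp x -> 0 <= 2 * f x - s x by move=> px; apply: le_trans (gs x px).
split => //.
apply: (linf_bounded_dual (c := `|2 * f A1 - s A1| + `|2 * f A2 - s A2|)) => //.
  exact: W0.
move=> y /Wi[h1 h2]; have := gp _ h1; have := gp _ h2; rewrite /= !(linfB fL) !(linfB sL).
rewrite ler_norml.
have := ler_norm (2 * f A2 - s A2); have := ler_norm (- (2 * f A1 - s A1)); rewrite normrN.
have := normr_ge0 (2 * f A1 - s A1); have := normr_ge0 (2 * f A2 - s A2).
by move=> *; apply/andP; split; lra.
Qed.

End Dual.

(** * Biorthogonal systems *)

Section Biorthogonal.
Variables (R : realType) (X : tvsType R).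
Implicit Types (sig : nat -> X -> R) (a : nat -> X) (p : X -> R).

Definition biorth sig a (N : nat) :=
  (forall k, (k < N)%N -> in_dual (sig k)) /\
  (forall i j, (i < N)%N -> (j < N)%N -> sig i (a j) = (i == j)%:R).

(** For a biorthogonal system, a projection onto the span of the [a k]. A linear [p] is unchanged by
    composition with it exactly when [p] lies in the span of the [sig k]. *)
Definition biproj sig a N (x : X) := \sum_(k < N) sig k x *: a k.

Lemma linf_biproj p sig a N x :
  (forall (b : R) x y, p (b *: x + y) = b * p x + p y) ->
  p (biproj sig a N x) = \sum_(k < N) sig k x * p (a k).
Proof. by move=> pL; rewrite /biproj linf_sum. Qed.

Lemma sig_biproj sig a n N x i : biorth sig a n -> (N <= n)%N -> (i < n)%N ->
  sig i (biproj sig a N x) = if (i < N)%N then sig i x else 0.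
Proof.
move=> [sd sa] Nn iN; rewrite linf_biproj; last by case: (sd i iN).
case: ifPn => iN'.
  rewrite (bigD1 (Ordinal iN'))//= sa// eqxx mulr1 big1 ?addr0// => j ji.
  by rewrite sa ?(leq_trans _ Nn)// eq_sym -(inj_eq val_inj)/= in ji *; rewrite (negPf ji) mulr0.
rewrite big1// => j _; rewrite sa//; last exact: leq_trans Nn.
by case: eqVneq => [ij|]; rewrite ?mulr0//; move: iN'; rewrite ij ltn_ord.
Qed.

(** A Gram-Schmidt step: the residual of [p] vanishes on the earlier vectors, and the earlier forms
    kill the normalised residual [c] of [b]. *)
Lemma biorth_step sig a N p b : biorth sig a N -> in_dual p ->
  p b != p (biproj sig a N b) ->
  exists c : X, [/\ in_dual (fun x => p x - p (biproj sig a N x)),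
    forall j, (j < N)%N -> p (a j) - p (biproj sig a N (a j)) = 0,
    forall i, (i < N)%N -> sig i c = 0,
    p c = 1 & biproj sig a N c = 0].
Proof.
move=> sa dp pb; have [sd saE] := sa; have [pL _] := dp.
pose r := p b - p (biproj sig a N b).
have r0 : r != 0 by rewrite subr_eq0.
pose c := r^-1 *: (b - biproj sig a N b).
have sc i : (i < N)%N -> sig i c = 0.
  move=> iN; have [sL _] := sd i iN.
  by rewrite /c (linfZ sL) (linfB sL) (sig_biproj _ sa)// iN subrr mulr0.
exists c; split => //.
- apply: dualB => //.
  rewrite (_ : (fun x => _) = fun x => \sum_(k < N) p (a k) * sig k x); last first.
    by apply/funext => x; rewrite linf_biproj//; apply: eq_bigr => *; rewrite mulrC.
  exact: (dual_sum (fun k => p (a k)) sd).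
- move=> j jN; rewrite linf_biproj// (bigD1 (Ordinal jN))//= saE// eqxx mul1r.
  rewrite big1 ?addr0 ?subrr// => i ij.
  by rewrite saE// -(inj_eq val_inj)/= in ij *; rewrite (negPf ij) mul0r.
- by rewrite /c (linfZ pL) (linfB pL) mulVf.
- by rewrite /biproj big1// => i _; rewrite sc// scale0r.
Qed.

(** Finite systems are lists of pairs, since appending keeps the earlier entries; [d] is the default
    of [nth] past the end. *)
Let d : (X -> R) * X := (cst 0, 0).
Let sigs (l : seq ((X -> R) * X)) k := (nth d l k).1.
Let vecs (l : seq ((X -> R) * X)) k := (nth d l k).2.
Let biorth_seq l := biorth (sigs l) (vecs l) (size l).

Let biorth_rcons l t c : biorth_seq l -> in_dual t ->
  (forall j, (j < size l)%N -> t (vecs l j) = 0) ->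
  (forall i, (i < size l)%N -> sigs l i c = 0) -> t c = 1 ->
  biorth_seq (rcons l (t, c)).
Proof.
move=> [sd sa] dt ta sc tc; split.
  move=> k; rewrite /sigs size_rcons ltnS leq_eqVlt nth_rcons => /predU1P[->|kl].
    by rewrite ltnn eqxx.
  by rewrite kl; exact: sd.
move=> i j; rewrite /sigs /vecs size_rcons !ltnS !nth_rcons.
rewrite leq_eqVlt => /predU1P[->|il]; rewrite leq_eqVlt => /predU1P[->|jl].
- by rewrite !ltnn !eqxx.
- by rewrite ltnn eqxx jl/= ta// (gtn_eqF jl).
- by rewrite il ltnn eqxx /= [LHS]sc// (ltn_eqF il).
- by rewrite il jl; exact: sa.
Qed.

Let biproj_rcons l t c x :
  biproj (sigs (rcons l (t, c))) (vecs (rcons l (t, c))) (size (rcons l (t, c))) x =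
  biproj (sigs l) (vecs l) (size l) x + t x *: c.
Proof.
rewrite /biproj size_rcons big_ord_recr/=; congr (_ + _).
  by apply: eq_bigr => i _; rewrite /sigs /vecs !nth_rcons ltn_ord.
by rewrite /sigs /vecs !nth_rcons ltnn eqxx.
Qed.

Let biorth_span (p : nat -> X -> R) n : (forall i, in_dual (p i)) ->
  exists l, biorth_seq l /\ forall i x, (i < n)%N ->
    p i x = p i (biproj (sigs l) (vecs l) (size l) x).
Proof.
move=> dp; elim: n => [|n [l [bl IH]]]; first by exists [::].
have [h|/existsNP[b /eqP pb]] :=
    pselect (forall x, p n x = p n (biproj (sigs l) (vecs l) (size l) x)).
  exists l; split => // i x; rewrite ltnS leq_eqVlt => /predU1P[->//|]; exact: IH.
have [c [dt ta sc pc Tc]] := biorth_step bl (dp n) pb.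
set t := fun x => _ in dt; exists (rcons l (t, c)).
have [L0 _] := dp n.
split; first by apply: biorth_rcons => //; rewrite /t pc Tc (linf0 L0) subr0.
move=> i x; rewrite ltnS leq_eqVlt biproj_rcons => /predU1P[->|i_n]; have [L _] := dp i.
  by rewrite (linfD L0) (linfZ L0) pc mulr1 /t addrC subrK.
by rewrite (linfD L) (linfZ L) (IH _ c)// Tc (linf0 L) mulr0 addr0 -IH.
Qed.

(** Dimension count: expressing [N + 1] forms through [N] gives a matrix with a nonzero left kernel
    vector, which is a linear relation. *)
Let independent_not_span (s : nat -> X -> R) l : biorth_seq l ->
  (forall n, in_dual (s n)) ->
  (forall (n : nat) (c : nat -> R),
      (forall x, \sum_(i < n) c i * s i x = 0) -> forall i, (i < n)%N -> c i = 0) ->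
  exists n b, s n b != s n (biproj (sigs l) (vecs l) (size l) b).
Proof.
move=> bl ds si; apply: contrapT => h.
have sE n x : s n x = s n (biproj (sigs l) (vecs l) (size l) x).
  by apply: contrapT => /eqP sx; apply: h; exists n, x.
set N := size l in sE.
pose M := \matrix_(i < N.+1, k < N) s i (vecs l k).
have /rowV0Pn[u /sub_kermxP uM u0] : kermx M != 0.
  rewrite kermx_eq0 /row_free; apply/eqP => rM.
  by have := rank_leq_col M; rewrite rM ltnn.
have := si N.+1 (fun i => u 0 (inord i)) _.
move=> /(_ _) uE; move/eqP: u0; apply; apply/rowP => i; rewrite mxE.
rewrite -(inord_val i); apply: uE => // x.
rewrite (eq_bigr (fun i : 'I_N.+1 => \sum_(k < N) sigs l k x * (u 0 i * M i k))).
  rewrite exchange_big/= big1// => k _; rewrite -mulr_sumr.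
  by have /rowP/(_ k) := uM; rewrite !mxE => ->; rewrite mulr0.
move=> j _; rewrite inord_val sE linf_biproj; last by case: (ds j).
by rewrite mulr_sumr; apply: eq_bigr => k _; rewrite mxE; ring.
Qed.

(** A finite system spanning the first [n] forms [p i] comes first; independence of the [s k] then
    always provides one more pair. *)
Lemma biorth_system (p s : nat -> X -> R) n : (forall i, in_dual (p i)) ->
  (forall n, in_dual (s n)) ->
  (forall (n : nat) (c : nat -> R),
      (forall x, \sum_(i < n) c i * s i x = 0) -> forall i, (i < n)%N -> c i = 0) ->
  exists m sig a, [/\ forall N, biorth sig a N &
    forall i x, (i < n)%N -> p i x = p i (biproj sig a m x)].
Proof.
move=> dp ds si; have [l0 [bl0 pl0]] := biorth_span n dp.
have /choice[next nextP] l : exists tc, biorth_seq l -> biorth_seq (rcons l tc).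
  have [bl|] := pselect (biorth_seq l); last by exists d.
  have [k [b sb]] := independent_not_span bl ds si.
  have [c [dt ta sc pc Tc]] := biorth_step bl (ds k) sb.
  have [L _] := ds k.
  set t := fun x => _ in dt; exists (t, c) => _.
  by apply: biorth_rcons => //; rewrite /t pc Tc (linf0 L) subr0.
pose ls n := iter n (fun l => rcons l (next l)) l0.
have bls k : biorth_seq (ls k) by elim: k => //= k; exact: nextP.
have sz k : size (ls k) = (size l0 + k)%N.
  by elim: k => [|k IH]; rewrite ?addn0//= size_rcons IH addnS.
have nthls k i j : (i < size (ls k))%N -> nth d (ls (k + j)%N) i = nth d (ls k) i.
  move=> ik; elim: j => [|j IH]; rewrite ?addn0// addnS/= nth_rcons.
  by rewrite sz addnA -sz ltn_addr.
have nthE k i : (i < size (ls k))%N -> nth d (ls i.+1) i = nth d (ls k) i.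
  move=> ik; have [ki|/ltnW ki] := leqP k i.+1.
    by rewrite -(subnKC ki) nthls.
  by rewrite -(subnKC ki) nthls// sz addnS ltnS leq_addl.
(* Entry [k] is read in [ls k.+1], whose length exceeds [k] whatever the size of [l0]. *)
exists (size l0), (fun k => sigs (ls k.+1) k), (fun k => vecs (ls k.+1) k); split.
  move=> N; have [bd ba] := bls N; have szN : (N <= size (ls N))%N by rewrite sz leq_addl.
  split=> [k kN|i j iN jN]; rewrite /sigs /vecs.
    by rewrite (nthE N) ?(leq_trans kN)//; apply: bd; apply: leq_trans szN.
  by rewrite !(nthE N) ?(leq_trans iN) ?(leq_trans jN)//; apply: ba; apply: leq_trans szN.
move=> i x i_n; rewrite pl0//; congr (p i _); apply: eq_bigr => k _.
by rewrite /sigs /vecs (nthE 0%N) ?sz ?addn0.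
Qed.

End Biorthogonal.

(** * The approximating sets *)

Lemma sum_split (V : nmodType) (F : nat -> V) N j :
  \sum_(k < N + j) F k = \sum_(k < N) F k + \sum_(k < j) F (N + k)%N.
Proof. by rewrite big_split_ord. Qed.

Lemma half_sum (R : realFieldType) N j :
  \sum_(k < j) 2^-1 ^+ (N + k).+1 <= 2^-1 ^+ N :> R.
Proof.
suff -> : \sum_(k < j) 2^-1 ^+ (N + k).+1 = 2^-1 ^+ N - 2^-1 ^+ (N + j) :> R.
  by rewrite lerBlDr lerDl exprn_ge0.
elim: j => [|j IH]; first by rewrite big_ord0 addn0 subrr.
by rewrite big_ord_recr/= IH addnS exprS; field.
Qed.

Lemma half_small (R : realType) (K e : R) m : 0 < e ->
  exists2 N, (m <= N)%N & K * 2^-1 ^+ N < e.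
Proof.
move=> e0; have [n Kn] : exists n : nat, K / e < n%:R.
  by exists (Num.truncn (K / e)).+1; rewrite truncnS_gt.
exists (m + n)%N; first exact: leq_addr.
rewrite exprVn -ltr_pdivlMr ?invr_gt0 ?exprn_gt0// invrK -ltr_pdivrMl// mulrC.
apply: lt_le_trans Kn _; rewrite -natrX ler_nat.
by apply: leq_trans (ltnW (ltn_expl n (ltnSn 1))) _; rewrite leq_exp2l// leq_addl.
Qed.

(** A bound free of square roots; it is the source of the factor [M + 1] below. *)
Lemma sqr_bounded (R : realFieldType) (x M : R) : x ^+ 2 <= M -> `|x| <= M + 1.
Proof.
move=> xM; have M0 : 0 <= M by apply: le_trans (sqr_ge0 x) xM.
rewrite -ler_sqr ?nnegrE ?addr_ge0// real_normK ?num_real//.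
by apply: le_trans xM _; nra.
Qed.

Section Approx.
Variables (R : realType) (X : tvsType R).
Implicit Types (s t p : X -> R).

(** Evaluation at a point is weak*-continuous, so closed half-spaces are weak*-closed. *)
Lemma wstar_closure_le (G : set (X -> R)) s x (c : R) : wstar_closure G s ->
  (forall t, G t -> t x <= c) -> s x <= c.
Proof.
move=> [_ Gs] Gc; apply/ler_addgt0Pr => e e0.
have [t Gt ts] := Gs [:: x] e e0; have := ts x (mem_head _ _).
by rewrite ltr_distl => /andP[+ _]; have := Gc t Gt; lra.
Qed.

Variables (Xp : set X) (C : set (X -> R)) (W : set X).
Variables (sig : nat -> X -> R) (a : nat -> X) (m : nat) (om : X -> R) (M kap : R).

(* Every condition is an intersection of half-spaces (the third one says
   sum_k (s - om)(a_k)^2 <= M), which makes the set visibly convex and closed;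
   the last one is a uniform form of s - om = sum_k (s - om)(a_k) sig_k. *)
Definition approx_set : set (X -> R) := [set s | [/\ in_dual s,
  C (fun x => s (biproj sig a m x) - om (biproj sig a m x)),
  forall N (y : nat -> R), s (\sum_(k < N) (2 * y k) *: a k) -
    om (\sum_(k < N) (2 * y k) *: a k) <= M + \sum_(k < N) y k ^+ 2 &
  forall N x, (m <= N)%N -> W x ->
    `|s (x - biproj sig a N x) - om (x - biproj sig a N x)| <= kap * 2^-1 ^+ N]].

Hypotheses (Cc : convex_fun_set C) (Ccl : wstar_closed C) (Cp : C `<=` dual_pos Xp).
Hypotheses (W0 : nbhs 0 W) (sa : forall N, biorth sig a N).
Hypothesis kap0 : 0 < kap.
(** Coordinates will be at most [M + 1] in absolute value: [sW] then makes the tails geometrically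
    small on [W], and [omp] lets [om] absorb them on the cone. *)
Hypothesis sW : forall k x, (m <= k)%N -> W x ->
  (M + 1) * `|sig k x| <= kap * 2^-1 ^+ k.+1.
Hypotheses (omd : in_dual om) (omW : forall x, W x -> `|om x| <= kap).
Hypothesis omp : forall j (y : nat -> R) x, (forall k, `|y k| <= M + 1) -> Xp x ->
  0 <= om x + \sum_(k < j) y k * sig (m + k)%N x.

Let sigd k : in_dual (sig k).
Proof. by case: (sa k.+1) => + _; apply. Qed.

Let sigL k : forall (b : R) x y, sig k (b *: x + y) = b * sig k x + sig k y.
Proof. by case: (sigd k). Qed.

Let sigaE i j : sig i (a j) = (i == j)%:R.
Proof. by case: (sa (maxn i j).+1) => _; apply; rewrite ltnS ?leq_maxl ?leq_maxr. Qed.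

Let sigproj N x i : sig i (biproj sig a N x) = if (i < N)%N then sig i x else 0.
Proof. by apply: (sig_biproj _ (sa (maxn N i.+1))); rewrite ?leq_maxl ?leq_maxr. Qed.

(** The part of [s] expanded along the system: [res s (a k)] is its coordinate of index [k]. *)
Let res s x := s x - om x.

Let resL s : in_dual s ->
  forall (b : R) x y, res s (b *: x + y) = b * res s x + res s y.
Proof. by move=> ds; have [] := dualB ds omd. Qed.

Lemma approx_convex : convex_fun_set approx_set.
Proof.
move=> s t l [ds Cs qs ts] [dt Ct qt tt] /[dup] l01 /andP[l0 l1].
have {}l1 : 0 <= 1 - l by rewrite subr_ge0.
have comb (u v w : R) : l * u + (1 - l) * v - w = l * (u - w) + (1 - l) * (v - w) by ring.
split.
- by apply: dualD; exact: dualZ.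
- have := Cc Cs Ct l01; congr C; apply/funext => x; rewrite comb; ring.
- move=> N y; rewrite comb; have := ler_wpM2l l0 (qs N y); have := ler_wpM2l l1 (qt N y).
  lra.
- move=> N x mN Wx; rewrite comb; apply: le_trans (ler_normD _ _) _.
  rewrite !normrM (ger0_norm l0) (ger0_norm l1).
  have := ler_wpM2l l0 (ts N x mN Wx); have := ler_wpM2l l1 (tt N x mN Wx).
  lra.
Qed.

Lemma approx_wstar_closed : wstar_closed approx_set.
Proof.
move=> s cs; have [ds ns] := cs; have [sL _] := ds; have [oL _] := omd.
split => //.
- apply: Ccl; split.
    rewrite (_ : (fun x => _) = fun x => \sum_(k < m) res s (a k) * sig k x).
      exact: (dual_sum (fun k => res s (a k))).
    apply/funext => x; rewrite -[LHS]/(res s _) (linf_biproj _ _ _ _ (resL ds)).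
    by apply: eq_bigr => *; rewrite mulrC.
  (* The condition on [C] only sees values at projected points, so [s] is approximated there. *)
  move=> F e e0; have [t [dt Ct _ _] ts] := ns (map (biproj sig a m) F) e e0.
  exists (fun x => t (biproj sig a m x) - om (biproj sig a m x)) => // x xF.
  have := ts (biproj sig a m x) (map_f _ xF).
  by rewrite opprB addrA subrK.
- move=> N y; rewrite lerBlDr; apply: (wstar_closure_le cs) => t [_ _ qt _].
  by rewrite -lerBlDr.
- move=> N x mN Wx; set v := x - _.
  have h1 : s v <= kap * 2^-1 ^+ N + om v.
    apply: (wstar_closure_le cs) => t [_ _ _ /(_ N x mN Wx)].
    by rewrite ler_norml => /andP[_]; rewrite lerBlDr.
  have h2 : s (- v) <= kap * 2^-1 ^+ N - om v.
    apply: (wstar_closure_le cs) => t [[tL _] _ _ /(_ N x mN Wx)].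
    by rewrite ler_norml (linfN tL) -/v => /andP[+ _]; lra.
  by rewrite ler_norml; move: h2; rewrite (linfN sL); lra.
Qed.

(** With the coordinates of [s] as [y], the third condition reads [2 * q <= M + q] for their sum of
    squares [q]. *)
Lemma approx_sqr s N : approx_set s -> \sum_(k < N) res s (a k) ^+ 2 <= M.
Proof.
move=> [ds _ /(_ N (fun k => res s (a k))) + _].
rewrite -[X in X <= _]/(res s _) (linf_sum (resL ds)).
rewrite (eq_bigr (fun k : 'I_N => 2 * res s (a k) ^+ 2)); last by move=> *; ring.
by rewrite -mulr_sumr; lra.
Qed.

Lemma approx_coord s k : approx_set s -> `|res s (a k)| <= M + 1.
Proof.
move=> /(approx_sqr k.+1) h; apply: sqr_bounded; apply: le_trans h.
by rewrite big_ord_recr/= lerDr sumr_ge0// => i _; rewrite sqr_ge0.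
Qed.

(** One [kap] pays for the tail beyond [m], the other for [om]. *)
Lemma approx_near s x : approx_set s -> W x ->
  `|s x - (s (biproj sig a m x) - om (biproj sig a m x))| <= 2 * kap.
Proof.
move=> [[sL _] _ _ /(_ m x (leqnn _)) h] Wx; have [oL _] := omd.
have -> : s x - (s (biproj sig a m x) - om (biproj sig a m x)) =
  (s (x - biproj sig a m x) - om (x - biproj sig a m x)) + om x.
  by rewrite (linfB sL) (linfB oL); ring.
apply: le_trans (ler_normD _ _) _; have := omW Wx; have := h Wx.
have : kap * 2^-1 ^+ m <= kap * 1.
  by rewrite ler_pM2l// exprn_ile1// invf_le1 ?ler1n.
lra.
Qed.

(** The gauge carries the tail condition from [W] to any point; hence the coordinates determine a
    member. *)
Lemma approx_tail s x : approx_set s -> exists K : R, forall N, (m <= N)%N ->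
  `|res s (x - biproj sig a N x)| <= K * 2^-1 ^+ N.
Proof.
move=> [ds _ _ h]; have [k k0 hk] := linf_gauge x W0.
exists (k * kap) => N mN; rewrite -mulrA.
apply: (hk (fun x => res s (x - biproj sig a N x))) => [b y z|y]; last exact: h.
have rL := resL ds.
rewrite !(linfB rL) !(linf_biproj _ _ _ _ rL) rL.
rewrite (eq_bigr (fun k : 'I_N => b * (sig k y * res s (a k)) + sig k z * res s (a k))).
  by rewrite big_split/= -mulr_sumr; ring.
by move=> i _; rewrite sigL; ring.
Qed.

(** Up to a vanishing tail, [s x] is the value of an element of [C] plus [om x] with finitely many
    terms beyond [m]; both parts are nonnegative on the cone. *)
Lemma approx_pos : approx_set `<=` dual_pos Xp.
Proof.
move=> s Ss; have [ds Cs _ _] := Ss; split => // x px.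
have [K hK] := approx_tail x Ss.
apply/ler_addgt0Pr => e e0; have [N mN KN] := half_small K m e0.
have := le_lt_trans (hK N mN) KN; rewrite ltr_norml => /andP[+ _].
have rL := resL ds; rewrite (linfB rL) (linf_biproj _ _ _ _ rL).
rewrite -(subnKC mN) (sum_split (fun k => sig k x * res s (a k))).
rewrite -(linf_biproj _ _ _ _ rL).
have [_ /(_ x px)] := Cp Cs.
have := @omp (N - m) (fun k => res s (a (m + k)%N)) x (fun k => approx_coord _ Ss) px.
rewrite (eq_bigr (fun k : 'I__ => sig (m + k)%N x * res s (a (m + k)%N))); last first.
  by move=> *; rewrite mulrC.
rewrite /res; lra.
Qed.

Section Finite.
Variables (N : nat) (y : nat -> R).
Hypotheses (yN : forall k, (N <= k)%N -> y k = 0) (yM : \sum_(k < N) y k ^+ 2 <= M).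
Hypothesis Cy : C (fun x => \sum_(k < m) y k * sig k x).

Let t x := om x + \sum_(k < N) y k * sig k x.

Let td : in_dual t.
Proof. by apply: dualD => //; exact: dual_sum. Qed.

Let rest x : res t x = \sum_(k < N) y k * sig k x.
Proof. by rewrite /res /t addrAC subrr add0r. Qed.

Let resta k : res t (a k) = y k.
Proof.
rewrite rest; have [kN|/yN y0] := ltnP k N.
  rewrite (bigD1 (Ordinal kN))//= sigaE eqxx mulr1 big1 ?addr0// => j jk.
  by rewrite sigaE; move: jk; rewrite -(inj_eq val_inj)/= => /negPf->; rewrite mulr0.
rewrite y0 big1// => j _; rewrite sigaE; case: eqVneq => [jk|_]; last by rewrite mulr0.
by rewrite jk y0 mul0r.
Qed.

Let sum_y n : \sum_(k < n) y k ^+ 2 <= M.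
Proof.
apply: le_trans yM; have [nN|/ltnW Nn] := leqP n N.
  rewrite -(subnKC nN) (sum_split (fun k => y k ^+ 2)) lerDl.
  by rewrite sumr_ge0// => *; exact: sqr_ge0.
rewrite -(subnKC Nn) (sum_split (fun k => y k ^+ 2)) gerDl.
by rewrite big1// => i _; rewrite yN ?leq_addr// expr0n.
Qed.

Let yk k : `|y k| <= M + 1.
Proof.
apply: sqr_bounded; apply: le_trans (sum_y k.+1).
by rewrite big_ord_recr/= lerDr sumr_ge0// => i _; rewrite sqr_ge0.
Qed.

Lemma approx_finite : approx_set (fun x => om x + \sum_(k < N) y k * sig k x).
Proof.
rewrite -/t; have rL := resL td; split => //.
- have := Cy; congr C; apply/funext => x; rewrite -[RHS]/(res t _).
  rewrite (linf_biproj _ _ _ _ rL); apply: eq_bigr => k _.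
  by rewrite resta mulrC.
- move=> n z; rewrite -[X in X <= _]/(res t _) (linf_sum rL).
  rewrite -lerBlDr -sumrB; apply: le_trans (sum_y n); apply: ler_sum => k _.
  by rewrite resta; have := sqr_ge0 (z k - y k); rewrite !expr2; lra.
move=> n x mn Wx; rewrite -[X in `|X|]/(res t _) rest.
have [Nn|/ltnW nN] := leqP N n.
  rewrite big1 ?normr0 ?mulr_ge0 ?ltW ?exprn_gt0// => k _.
  by rewrite (linfB (sigL k)) sigproj (leq_trans (ltn_ord k) Nn) subrr mulr0.
(* The projection cancels the terms below [n]; [sW] bounds the others by a geometric series. *)
rewrite -(subnKC nN) (sum_split (fun k => y k * sig k (x - biproj sig a n x))).
rewrite big1 ?add0r; last first.
  by move=> k _; rewrite (linfB (sigL k)) sigproj ltn_ord subrr mulr0.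
apply: le_trans (ler_norm_sum _ _ _) _.
apply: le_trans (_ : kap * \sum_(k < N - n) 2^-1 ^+ (n + k).+1 <= _); last first.
  by rewrite ler_pM2l// half_sum.
rewrite mulr_sumr; apply: ler_sum => k _.
rewrite (linfB (sigL _)) sigproj ltnNge leq_addr/= subr0 normrM.
apply: le_trans (sW (k := (n + k)%N) _ Wx); last by rewrite (leq_trans mn)// leq_addr.
by rewrite ler_wpM2r.
Qed.

(* The exposing element is [sum_k y_k a_k], on which [s - om] is the inner
   product of the coordinates of [s] with [y]. *)
Lemma approx_finite_exposed : \sum_(k < N) y k ^+ 2 = M ->
  exposed_points approx_set (fun x => om x + \sum_(k < N) y k * sig k x).
Proof.
move=> yE; split; first exact: approx_finite.
rewrite -/t; exists (\sum_(k < N) y k *: a k) => s Ss st.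
set v := \sum_(k < N) _; have [ds _ _ hs] := Ss.
rewrite ltNge; apply/negP => tsv; apply: st.
(* The coordinate vectors have inner product at least [M] and squared norms at most [M], so their
   distance is 0. *)
have rsv : \sum_(k < N) y k * res s (a k) >= M.
  rewrite -(linf_sum (resL ds)) -/v -yE.
  have -> : \sum_(k < N) y k ^+ 2 = res t v.
    by rewrite /v (linf_sum (resL td)); apply: eq_bigr => k _; rewrite resta.
  by rewrite /res lerB.
have seq k : res s (a k) = y k.
  (* Long enough to contain the index [k] and every nonzero coordinate of [y]. *)
  pose n := (N + k.+1)%N.
  have h : \sum_(k < n) (res s (a k) - y k) ^+ 2 <= 0.
    rewrite (eq_bigr (fun k : 'I_n =>
      res s (a k) ^+ 2 + y k ^+ 2 - 2 * (y k * res s (a k)))); last first.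
      by move=> *; ring.
    rewrite sumrB big_split/= -mulr_sumr.
    have := approx_sqr n Ss; have := sum_y n.
    suff : \sum_(k < n) y k * res s (a k) = \sum_(k < N) y k * res s (a k) by lra.
    rewrite (sum_split (fun k => y k * res s (a k))) [X in _ + X]big1 ?addr0// => i _.
    by rewrite yN ?mul0r// leq_addr.
  have kn : (k < n)%N by rewrite /n addnS ltnS leq_addl.
  apply/eqP; rewrite -subr_eq0 -sqrf_eq0 eq_le sqr_ge0 andbT.
  apply: le_trans h; rewrite (bigD1 (Ordinal kn))//= lerDl.
  by rewrite sumr_ge0// => *; rewrite sqr_ge0.
apply/funext => x.
have [K hK] := approx_tail x Ss; have [K' hK'] := approx_tail x approx_finite.
have proj_eq n : res s (biproj sig a n x) = res t (biproj sig a n x).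
  rewrite (linf_biproj _ _ _ _ (resL ds)) (linf_biproj _ _ _ _ (resL td)).
  by apply: eq_bigr => k _; rewrite seq resta.
(* Equal coordinates leave only the two tails, which vanish in the limit. *)
suff : `|res s x - res t x| <= 0.
  by rewrite normr_le0 subr_eq0 => /eqP; rewrite /res => /addIr.
apply/ler_addgt0Pr => e e0; rewrite add0r.
have [n mn Kn] := half_small (K + K') m e0; apply: le_trans (ltW Kn).
have -> : res s x - res t x = res s (x - biproj sig a n x) - res t (x - biproj sig a n x).
  by rewrite (linfB (resL ds)) (linfB (resL td)) proj_eq; ring.
rewrite mulrDl; apply: le_trans (ler_normB _ _) _.
by rewrite lerD// ?hK// hK'.
Qed.

End Finite.

(* A large coefficient on a remote [sig N] brings a truncation of [s] to the
   sphere while barely moving it in the weak* topology. *)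
Lemma approx_dense : approx_set `<=` wstar_closure (exposed_points approx_set).
Proof.
move=> s Ss; have [ds Cs _ hs] := Ss; split => // F e e0; have rL := resL ds.
(* One gauge constant serves all the finitely many test points. *)
have [K [K0 hK]] : exists K : R, 0 <= K /\ forall x, x \in F -> forall u c, 0 <= c ->
    (forall (b : R) x y, u (b *: x + y) = b * u x + u y) ->
    (forall y, W y -> `|u y| <= c) -> `|u x| <= K * c.
  elim: F => [|x F [K [K0 IH]]]; first by exists 0.
  have [k k0 hk] := linf_gauge x W0; exists (k + K); split; first by rewrite addr_ge0// ltW.
  move=> z; rewrite inE => /orP[/eqP->|zF] u c c0 uL uW; rewrite mulrDl.
    by apply: le_trans (hk _ _ uL uW) _; rewrite lerDl mulr_ge0.
  by apply: le_trans (IH _ zF _ _ c0 uL uW) _; rewrite lerDr mulr_ge0// ltW.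
(* [2 * kap] covers the tail of [s] and the term added at index [N]; [m <= N] keeps that term out of
   the condition on [C]. *)
have [N mN KN] := half_small (K * (2 * kap)) m e0.
pose z := Num.sqrt (M - \sum_(k < N) res s (a k) ^+ 2).
pose y k := if (k < N)%N then res s (a k) else if k == N then z else 0.
have yE (F' : nat -> R -> R) :
    \sum_(k < N.+1) F' k (y k) = \sum_(k < N) F' k (res s (a k)) + F' N z.
  rewrite big_ord_recr/= /y ltnn eqxx; congr (_ + _).
  by apply: eq_bigr => k _; rewrite ltn_ord.
have yM : \sum_(k < N.+1) y k ^+ 2 = M.
  rewrite (yE (fun _ u => u ^+ 2)) sqr_sqrtr ?subrKC// subr_ge0.
  exact: approx_sqr.
have yN k : (N.+1 <= k)%N -> y k = 0.
  by move=> Nk; rewrite /y ltnNge ltnW//= gtn_eqF.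
have Cy : C (fun x => \sum_(k < m) y k * sig k x).
  have := Cs; congr C; apply/funext => x; rewrite -[LHS]/(res s _) (linf_biproj _ _ _ _ rL).
  by apply: eq_bigr => k _; rewrite /y (leq_trans (ltn_ord k) mN) mulrC.
pose t x := om x + \sum_(k < N.+1) y k * sig k x; exists t.
  by apply: approx_finite_exposed => //; rewrite yM.
move=> x xF.
have td : in_dual t by apply: dualD => //; exact: dual_sum.
apply: le_lt_trans KN; rewrite -mulrA.
have [tsL _] := dualB td ds.
apply: (hK x xF (fun x => t x - s x)) => //.
  by rewrite !mulr_ge0// ltW// exprn_gt0.
move=> {xF} {}x Wx.
have -> : t x - s x = z * sig N x - res s (x - biproj sig a N x).
  rewrite (linfB rL) (linf_biproj _ _ _ _ rL) /t (yE (fun k u => u * sig k x)) /res.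
  rewrite [X in _ - (_ - X)](eq_bigr (fun k : 'I_N => res s (a k) * sig k x)).
    by rewrite /res; ring.
  by move=> *; rewrite mulrC.
have zM : `|z| <= M + 1.
  have -> : z = y N by rewrite /y ltnn eqxx.
  apply: sqr_bounded; rewrite -yM big_ord_recr/= lerDr.
  by rewrite sumr_ge0// => *; rewrite sqr_ge0.
apply: le_trans (ler_normB _ _) _; have := hs N x mN Wx.
have : `|z * sig N x| <= kap * 2^-1 ^+ N.+1.
  by rewrite normrM; apply: le_trans (sW mN Wx); rewrite ler_wpM2r.
rewrite exprS /res; have : 0 < kap * 2^-1 ^+ N by rewrite mulr_gt0// exprn_gt0.
lra.
Qed.

End Approx.

(** * Convergence *)

Section HausdorffConvergence.
Variables (R : realType) (X : tvsType R).

Lemma dH_ge0 (A : X) (F G : set (X -> R)) : F !=set0 -> (0 <= dH A F G)%E.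
Proof.
move=> [s Fs]; rewrite /dH le_max; apply/orP; left.
apply: le_ereal_sup_tmp; exists (ereal_inf [set `|s A - t A|%:E | t in G]).
  by exists s.
by apply: le_ereal_inf_tmp => _ [t _ <-]; rewrite lee_fin.
Qed.

Lemma dH_le (A : X) (F G : set (X -> R)) (e : R) :
  (forall s, F s -> exists2 t, G t & `|s A - t A| <= e) ->
  (forall t, G t -> exists2 s, F s & `|s A - t A| <= e) ->
  (dH A F G <= e%:E)%E.
Proof.
move=> FG GF; rewrite /dH ge_max; apply/andP; split.
  apply: ge_ereal_sup => _ [s Fs <-]; have [t Gt st] := FG s Fs.
  by apply: ge_ereal_inf; exists (`|s A - t A|%:E); rewrite ?lee_fin//; exists t.
apply: ge_ereal_sup => _ [t Gt <-]; have [s Fs st] := GF t Gt.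
by apply: ge_ereal_inf; exists (`|s A - t A|%:E); rewrite ?lee_fin//; exists s.
Qed.

Lemma hausdorff_cvgP (Un : nat -> set (X -> R)) (U : set (X -> R)) :
  (forall n, Un n !=set0) ->
  (forall A (e : R), 0 < e -> \forall n \near \oo,
    (forall s, Un n s -> exists2 t, U t & `|s A - t A| <= e) /\
    (forall t, U t -> exists2 s, Un n s & `|s A - t A| <= e)) ->
  hausdorff_cvg Un U.
Proof.
move=> Un0 h A.
have le0 n : (0 <= dH A (Un n) U)%E by exact: dH_ge0.
apply/fine_cvgP; split.
  have := h A 1 ltr01; apply: filterS => n [h1 h2].
  by rewrite ge0_fin_numE//; apply: le_lt_trans (dH_le h1 h2) _; rewrite ltry.
apply/cvgrPdist_le => e e0; have := h A e e0; apply: filterS => n [h1 h2] /=.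
have := dH_le h1 h2; rewrite sub0r normrN.
case: (dH A (Un n) U) (le0 n) => [r| |]//=; rewrite !lee_fin => r0.
by rewrite ger0_norm.
Qed.

End HausdorffConvergence.

(** * Series of functionals that decrease geometrically on a 0-neighborhood *)

Section Series.
Variables (R : realType) (X : tvsType R) (W : set X) (W0 : nbhs 0 W).
Variables (g : nat -> X -> R) (kap : R).
Hypotheses (gd : forall k, in_dual (g k)).
Hypothesis gW : forall k x, W x -> `|g k x| <= kap * 2^-1 ^+ k.+1.

(** The gauge extends the geometric bound to each point, so the series converges absolutely; the sum
    stays bounded on [W], hence is continuous. *)
Lemma dual_series : exists om : X -> R, [/\ in_dual om,
  forall x, W x -> `|om x| <= kap &
  forall x, (forall k, 0 <= g k x) -> forall n, \sum_(k < n) g k x <= om x].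
Proof.
have kap0 : 0 <= kap.
  have := gW 0 (nbhs_singleton W0); have := normr_ge0 (g 0 0).
  by rewrite expr1 => h1 h2; have := le_trans h1 h2; rewrite pmulr_lge0// invr_gt0.
have norm_sum x K n : (forall k, `|g k x| <= K * 2^-1 ^+ k.+1) -> 0 <= K ->
    \sum_(k < n) `|g k x| <= K.
  move=> gK K0; apply: le_trans (_ : K * \sum_(k < n) 2^-1 ^+ (0 + k).+1 <= _).
    by rewrite mulr_sumr; apply: ler_sum.
  by rewrite -[leRHS]mulr1 ler_wpM2l// -(expr0 2^-1) half_sum.
have gx x : exists2 K, 0 <= K & forall k, `|g k x| <= K * 2^-1 ^+ k.+1.
  have [l l0 hl] := linf_gauge x W0; exists (l * kap); first by rewrite mulr_ge0// ltW.
  by move=> k; rewrite -mulrA; apply: hl => [|y]; [case: (gd k)|exact: gW].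
pose u x n := \sum_(k < n) g k x.
have uE x : u x = series (g^~ x) by apply/funext => n; rewrite /u seriesEord.
have cu x : cvgn (u x).
  have [K K0 gK] := gx x; rewrite uE; apply: normed_cvg.
  apply: nondecreasing_is_cvgn.
    apply: nondecreasing_series => *; exact: normr_ge0.
  exists K => _ [n _ <-]; have := norm_sum x K n gK K0.
    by rewrite -(big_mkord xpredT (fun k => `|g k x|)).
pose om x := limn (u x).
have omL (b : R) x y : om (b *: x + y) = b * om x + om y.
  rewrite /om; apply: cvg_lim => //.
  have -> : u (b *: x + y) = fun n => b * u x n + u y n.
    apply/funext => n; rewrite /u mulr_sumr -big_split/=; apply: eq_bigr => k _.
    by have [-> _] := gd k.
  exact: (cvgD (cvgMl_tmp (a := b) (cu x)) (cu y)).
have omW x : W x -> `|om x| <= kap.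
  move=> Wx; have un n : `|u x n| <= kap.
    by apply: le_trans (ler_norm_sum _ _ _) _; apply: norm_sum => // k; exact: gW.
  rewrite ler_norml; apply/andP; split.
    by apply: limr_ge => //; apply: nearW => n; have := un n; rewrite ler_norml => /andP[].
  by apply: limr_le => //; apply: nearW => n; have := un n; rewrite ler_norml => /andP[].
exists om; split => //; first exact: linf_bounded_dual W0 omL omW.
move=> x gp n; apply: (nondecreasing_cvgn_le (u_ := u x)) => //.
by rewrite uE; apply: nondecreasing_series => *; exact: gp.
Qed.

End Series.

(** * Approximation of one set, uniformly on a 0-neighborhood *)

Section Approximation.
Variables (R : realType) (X : tvsType R) (Xp : set X).

(** Meant for the values at one [A] of a near-maximiser ([b]) and a near-minimiser ([c]): the
    segment between them approaches every value [u] taken on the set. *)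
Lemma interpolate (b c u e : R) : 0 <= e -> u - e <= b -> c <= u + e ->
  exists2 l : R, 0 <= l <= 1 & `|l * b + (1 - l) * c - u| <= e.
Proof.
move=> e0 ub cu; have [bu|bu] := leP b u.
  by exists 1; rewrite ?ler01 ?lexx// ler_norml; apply/andP; split; lra.
have [uc|uc] := leP u c.
  by exists 0; rewrite ?ler01 ?lexx// ler_norml; apply/andP; split; lra.
have bc : 0 < b - c by lra.
exists ((u - c) / (b - c)).
  apply/andP; split; first by apply: divr_ge0; lra.
  by rewrite ler_pdivrMr// mul1r; lra.
suff -> : (u - c) / (b - c) * b + (1 - (u - c) / (b - c)) * c - u = 0 by rewrite normr0.
by field; rewrite gt_eqF.
Qed.

(** Near-maximisers are chosen for each point of a countable dense set and each tolerance;
    equicontinuity of the polar makes them serve nearby points too. *)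
Lemma dense_supporting_points (U : set X) (C : set (X -> R)) :
  (exists D : set X, countable D /\ dense D) -> nbhs 0 U ->
  C `<=` polar U -> C !=set0 ->
  exists p : nat -> X -> R, (forall i, C (p i)) /\
    forall x (e : R), 0 < e -> exists i, forall s, C s -> s x - e <= p i x.
Proof.
move=> [D [/countable_injP[f finj] Dd]] U0 CinU [p0 Cp0].
have near_sup d (e : R) : 0 < e -> exists2 p, C p & forall s, C s -> s d - e <= p d.
  move=> e0; have [K K0 hK] := linf_gauge d U0.
  pose E := [set s d | s in C].
  have hsE : has_sup E.
    split; first by exists (p0 d), p0.
    exists (K * 1) => _ [s Cs <-]; apply: le_trans (ler_norm _) _.
    by have [[sL _] sU] := CinU s Cs; apply: hK.
  have [_ [p Cp <-] pE] := sup_adherent e0 hsE.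
  exists p => // s Cs; have : s d <= sup E by apply: ub_le_sup; [case: hsE|exists s].
  lra.
have /choice[P PP] (nk : nat * nat) : exists p, C p /\
    forall d, D d -> f d = nk.1 -> forall s, C s -> s d - nk.2.+1%:R^-1 <= p d.
  have [[d Dd' fd]|h] := pselect (exists2 d, D d & f d = nk.1); last first.
    by exists p0; split => // d Dd' fd; case: h; exists d.
  have [|p Cp hp] := near_sup d nk.2.+1%:R^-1; first by rewrite invr_gt0.
  exists p; split => // d' Dd'' fd'; suff -> : d' = d by [].
  by apply: finj; rewrite ?inE// fd fd'.
(* [pickle] enumerates the pairs of a dense point's code and a tolerance; the default pair is
   harmless, as every choice lies in [C]. *)
exists (fun i => P (odflt (0, 0)%N (unpickle i))); split => [i|x e e0].
  by have [] := PP (odflt (0, 0)%N (unpickle i)).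
(* The tolerance and the changes of [s] and [p] between [x] and [d] cost at most [e / 4] each. *)
have r0 : e / 4 != 0 by lra.
have [d [[_ [v Uv <-] <-] Dd']] : (+%R x @` ( *:%R (e / 4) @` U) `&` D) !=set0.
  have := nbhsT x (nbhs0Z r0 U0); rewrite nbhsE => -[V [oV Vx] VU].
  have [y [Vy Dy]] := Dd V (ex_intro _ x Vx) oV.
  by exists y; split => //; exact: VU.
have [k ke] : exists k : nat, k.+1%:R^-1 <= e / 4.
  exists (Num.truncn (e / 4)^-1); rewrite invf_ple ?posrE//; last by lra.
  by apply: ltW; rewrite truncnS_gt.
exists (pickle (f (x + (e / 4) *: v), k)); rewrite pickleK/= => s Cs.
have [Cp hp] := PP (f (x + (e / 4) *: v), k); have := hp _ Dd' erefl s Cs.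
set p := P _ in Cp hp *.
have [[sL _] /(_ v Uv)] := CinU _ Cs; have [[pL _] /(_ v Uv)] := CinU _ Cp.
rewrite (linfD sL) (linfD pL) (linfZ sL) (linfZ pL) !ler_norml/=.
move=> /andP[p1 p2] /andP[s1 s2].
have e4 : 0 <= e / 4 by lra.
have := ler_wpM2l e4 p2; have := ler_wpM2l e4 s1; rewrite mulr1 mulrN1.
move: ke; move: (e / 4 * s v) (e / 4 * p v) (k.+1%:R^-1) => u w h; lra.
Qed.

Variables (A1 A2 : X) (W : set X).
Hypotheses (W0 : nbhs 0 W) (Wi : W `<=` cone_interval Xp A1 A2).
Hypothesis dominated : forall s, in_dual s ->
  exists2 g, dual_pos Xp g & forall x, Xp x -> `|s x| <= g x.

Let dominated_bounded s : in_dual s -> exists g (b : R), [/\ dual_pos Xp g, 0 < b,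
  forall x, Xp x -> `|s x| <= g x, forall x, W x -> `|g x| <= b &
  forall x, W x -> `|s x| <= b].
Proof.
move=> ds; have [g gp sg] := dominated ds; have [[gL _] _] := gp; have [sL _] := ds.
(* On [W], [c] bounds [g], while [s] differs from [s A1] by at most [g x - g A1]. *)
pose c := `|g A1| + `|g A2|; exists g, (c + 1 + `|s A1| + `|g A1|).
have c0 : 0 <= c by rewrite addr_ge0.
have gc x : W x -> `|g x| <= c by move=> /Wi; exact: dual_pos_bounded.
split => //; first by have := normr_ge0 (s A1); have := normr_ge0 (g A1); lra.
  by move=> x /gc; have := normr_ge0 (s A1); have := normr_ge0 (g A1); lra.
move=> x Wx; have [/sg + _] := Wi Wx; rewrite (linfB sL) (linfB gL) => h.
have := gc x Wx; have := ler_norm (g x); have := ler_norm (- g A1); rewrite normrN.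
have := ler_normD (s x - s A1) (s A1); rewrite subrK; lra.
Qed.

(** Scaling [sig k] by [ga k] and [a k] by its inverse keeps biorthogonality; [om] sums the
    dominating [g k], scaled alike and multiplied by [mu]. *)
Lemma rescale (sig : nat -> X -> R) (a : nat -> X) m (mu kap : R) :
  0 < mu -> 0 < kap -> (forall N, biorth sig a N) ->
  exists sig' a' om, [/\ forall N, biorth sig' a' N,
    forall k, (k < m)%N -> sig' k = sig k /\ a' k = a k,
    forall k x, (m <= k)%N -> W x -> mu * `|sig' k x| <= kap * 2^-1 ^+ k.+1,
    in_dual om /\ (forall x, W x -> `|om x| <= kap) &
    forall j (y : nat -> R) x, (forall k, `|y k| <= mu) -> Xp x ->
      0 <= om x + \sum_(k < j) y k * sig' (m + k)%N x].
Proof.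
move=> mu0 kap0 sa; have sigd k : in_dual (sig k) by case: (sa k.+1) => + _; apply.
have /choice[g gP] k := dominated_bounded (sigd k).
have /choice[b {}gP] k := gP k.
(* Chosen so that [mu * (ga k * b k)] is [kap * 2^-1 ^+ k.+1] from [m] on. *)
pose ga k := if (k < m)%N then 1 else kap * 2^-1 ^+ k.+1 / (mu * b k).
have ga0 k : 0 < ga k.
  rewrite /ga; case: ifP => // _; have [_ b0 _ _ _] := gP k.
  by rewrite divr_gt0// mulr_gt0// exprn_gt0.
have small k (c : R) : (m <= k)%N -> c <= b k -> mu * (ga k * c) <= kap * 2^-1 ^+ k.+1.
  move=> mk cb; rewrite /ga ltnNge mk/=; have [_ b0 _ _ _] := gP k.
  have -> : mu * (kap * 2^-1 ^+ k.+1 / (mu * b k) * c) = kap * 2^-1 ^+ k.+1 * (c / b k).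
    by field; rewrite !gt_eqF.
  by rewrite ger_pMr ?mulr_gt0 ?exprn_gt0// ler_pdivrMr// mul1r.
pose G k x := mu * (ga (m + k)%N * g (m + k)%N x).
have Gd k : in_dual (G k) by do 2 apply: dualZ; case: (gP (m + k)%N) => -[].
have GW k x : W x -> `|G k x| <= kap * 2^-1 ^+ k.+1.
  move=> Wx; rewrite /G !normrM (gtr0_norm mu0) (gtr0_norm (ga0 _)).
  apply: le_trans (small _ _ _ _) _; rewrite ?leq_addr//.
    by case: (gP (m + k)%N) => _ _ _ + _; apply.
  by rewrite ler_pM2l// ler_wiXn2l ?invr_ge0 ?invf_le1 ?ler1n// ltnS leq_addl.
have [om [omd omW omG]] := dual_series W0 Gd GW.
exists (fun k x => ga k * sig k x), (fun k => (ga k)^-1 *: a k), om; split => //.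
- move=> N; split=> [k _|i j iN jN]; first exact: dualZ.
  have [_ saE] := sa N; have [sL _] := sigd i; rewrite (linfZ sL) saE//.
  by case: eqVneq => [->|_]; rewrite ?mulr0// mulr1 mulfV// gt_eqF.
- move=> k km; rewrite /ga km invr1 scale1r; split => //.
  by apply/funext => x; rewrite mul1r.
- move=> k x mk Wx; rewrite normrM (gtr0_norm (ga0 _)); apply: small => //.
  by case: (gP k) => _ _ _ _; apply.
move=> j y x ymu px; have G0 k : 0 <= G k x.
  have g0 : 0 <= g (m + k)%N x.
    by case: (gP (m + k)%N) => _ _ + _ _ => /(_ x px); exact: le_trans.
  exact: mulr_ge0 (ltW mu0) (mulr_ge0 (ltW (ga0 _)) g0).
apply: le_trans (_ : 0 <= \sum_(k < j) (G k x + y k * (ga (m + k)%N * sig (m + k)%N x))) _.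
  apply: sumr_ge0 => k _; rewrite -lerBlDr sub0r.
  apply: le_trans (ler_norm _) _; rewrite normrN !normrM (gtr0_norm (ga0 _)).
  apply: ler_pM => //; first exact: mulr_ge0 (ltW (ga0 _)) _.
  by rewrite ler_pM2l//; case: (gP (m + k)%N) => _ _ + _ _; apply.
by rewrite big_split/= lerD2r; exact: omG.
Qed.

(** Reaching the segments between two of the [p i] is enough, because convergence is tested at one
    [A] at a time. *)
Lemma dense_exposed_approx (U : set X) (C : set (X -> R)) (s p : nat -> X -> R) n (kap : R) :
  nbhs 0 U -> CU_pos Xp U C -> (forall i, C (p i)) -> 0 < kap ->
  (forall n, in_dual (s n)) ->
  (forall (n : nat) (c : nat -> R),
      (forall x, \sum_(i < n) c i * s i x = 0) -> forall i, (i < n)%N -> c i = 0) ->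
  exists S : set (X -> R), [/\ convex_fun_set S, wstar_closed S, S `<=` dual_pos Xp,
    S = wstar_closure (exposed_points S) &
    (forall t, S t -> exists2 q, C q & forall x, W x -> `|t x - q x| <= 2 * kap) /\
    forall i j l, (i < n)%N -> (j < n)%N -> 0 <= l <= 1 ->
      exists2 t, S t & forall x, W x -> `|t x - (l * p i x + (1 - l) * p j x)| <= 2 * kap].
Proof.
move=> U0 [[C0 [Cc [Ccl CinU]]] Cp] pC kap0 ds si.
have pd i : in_dual (p i) by have [] := CinU _ (pC i).
have [m [sig0 [a0 [sa0 pm0]]]] := biorth_system n pd ds si.
have /choice[K hK] k : exists K : R, forall q, C q -> `|q (a0 k)| <= K.
  have [K K0 hK] := linf_gauge (a0 k) U0; exists (K * 1) => q /CinU[[qL _] qU].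
  exact: hK.
(* Large enough for the ball to contain all points of [C] in the span of the first [m] forms. *)
pose M := \sum_(k < m) K k ^+ 2.
have M0 : 0 <= M by apply: sumr_ge0 => *; exact: sqr_ge0.
have mu0 : 0 < M + 1 by rewrite ltr_wpDl.
have [sig [a [om [sa saE sW [omd omW] omp]]]] := rescale m mu0 kap0 sa0.
have pm i x : (i < n)%N -> p i x = \sum_(k < m) p i (a k) * sig k x.
  move=> i_n; have [pL _] := pd i; rewrite pm0// linf_biproj//.
  by apply: eq_bigr => k _; have [-> ->] := saE k (ltn_ord k); rewrite mulrC.
pose S := approx_set C W sig a m om M kap.
have Scl : wstar_closed S by exact: approx_wstar_closed.
exists S; split => //.
- exact: approx_convex.
- exact: (approx_pos Cp W0 sa omd omp).
- apply/seteqP; split; first exact: (approx_dense W0 sa kap0 sW omd).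
  by move=> t [dt ct]; apply: Scl; split => // F e /(ct F)[u [Su _] ut]; exists u.
split=> [t St|i j l i_n j_n l01].
  exists (fun x => t (biproj sig a m x) - om (biproj sig a m x)); first by case: St.
  by move=> x; apply: (approx_near kap0 omd omW St).
pose q x := l * p i x + (1 - l) * p j x.
have Cq : C q by exact: Cc.
have qm x : q x = \sum_(k < m) q (a k) * sig k x.
  rewrite /q (pm i)// (pm j)// !mulr_sumr -big_split; apply: eq_bigr => k _.
  by rewrite /=; ring.
pose y k := if (k < m)%N then q (a k) else 0.
have yE x : \sum_(k < m) y k * sig k x = q x.
  by rewrite qm; apply: eq_bigr => k _; rewrite /y ltn_ord.
exists (fun x => om x + \sum_(k < m) y k * sig k x).
  apply: approx_finite => //.
  - by move=> k; rewrite /y ltnNge => ->.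
  - apply: ler_sum => k _; rewrite /y ltn_ord; have [_ ->] := saE k (ltn_ord k).
    have qK := hK k q Cq; have K0 : 0 <= K k by apply: le_trans qK.
    by rewrite -real_normK ?num_real// ler_sqr ?nnegrE.
  - by move: Cq; congr C; apply/funext => x; rewrite yE.
move=> x Wx; rewrite yE -/(q x) addrK; apply: le_trans (omW x Wx) _; lra.
Qed.

End Approximation.

Theorem theorem4p14 (R : realType) (X : tvsType R) (Xp : set X) :
  hausdorff_space X ->
  (exists D : set X, countable D /\ dense D) ->
  convex_cone Xp ->
  (forall U : set X, nbhs 0 U ->
     exists (A1 A2 : X) (Ut : set X),
       nbhs 0 Ut /\ Ut `<=` cone_interval Xp A1 A2 /\ cone_interval Xp A1 A2 `<=` U) ->
  forall U : set X, nbhs 0 U -> infdim_cond U ->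
  forall C : set (X -> R), CU_pos Xp U C ->
  exists Ut : set X, nbhs 0 Ut /\ Ut `<=` U /\
    exists Cn : nat -> set (X -> R),
      (forall n, D0_pos Xp Ut (Cn n)) /\ hausdorff_cvg Cn C.
Proof.
move=> _ sepX cX itv U U0 [s [ds [si _]]] C CC.
have [[C0 [Cc [Ccl CinU]]] Cp] := CC.
have [A1 [A2 [W [W0 [Wi _]]]]] := itv U U0.
have dominated t : in_dual t ->
    exists2 g, dual_pos Xp g & forall x, Xp x -> `|t x| <= g x.
  move=> dt; apply: dual_dominated => //.
  by have [B1 [B2 [V [V0 [Vi iV]]]]] := itv _ (dual_bounded dt); exists B1, B2, V.
have [p [pC psup]] := dense_supporting_points sepX U0 CinU C0.
pose kap n : R := 4^-1 * 2^-1 ^+ n.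
have kap0 n : 0 < kap n by rewrite mulr_gt0 ?invr_gt0 ?exprn_gt0.
have /choice[Cn CnP] n := dense_exposed_approx W0 Wi dominated n.+1 U0 CC pC (kap0 n) ds si.
have Cn0 n : Cn n !=set0.
  have [_ _ _ _ [_ /(_ 0 0 1)]] := CnP n.
  by rewrite ler01 lexx => /(_ erefl erefl erefl)[t Ct _]; exists t.
(* Here [U (2 *: x)] bounds elements of [C] by one half, and the perturbation [2 * kap n] is at most
   one half, so [Cn n] stays in the polar. *)
exists [set x | [/\ U x, U (2 *: x) & W x]]; split.
  have U2 : nbhs (0 : X) [set x | U (2 *: x)].
    have h2 : (2^-1 : R) != 0 by rewrite invr_neq0.
    apply: filterS (nbhs0Z h2 U0) => _ [x Ux <-].
    by rewrite /= scalerA mulfV ?scale1r.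
  by apply: filterS (filterI (filterI U0 U2) W0) => x [[]].
split; first by move=> x [].
exists Cn; split=> [n|].
  have [cv cl pos ex [near _]] := CnP n.
  have CUn : CU [set x | [/\ U x, U (2 *: x) & W x]] (Cn n).
    split => //; split => //; split => // t Ct; have [dt _] := pos t Ct.
    split => // x [Ux U2x Wx]; have [q Cq tq] := near t Ct.
    have [[qL _] /(_ _ U2x)] := CinU q Cq; rewrite (linfZ qL) normrM ger0_norm// => q2.
    have := tq x Wx; have := ler_normD (t x - q x) (q x); rewrite subrK.
    have : kap n <= 4^-1 by rewrite ger_pMr ?invr_gt0// exprn_ile1// invf_le1 ?ler1n.
    lra.
  by split; split.
apply: hausdorff_cvgP => // A e e0.
have [k k0 hk] := linf_gauge A W0.
have e2 : 0 < e / 2 by rewrite divr_gt0.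
(* Over [C], [p i] nearly maximises and [p j] nearly minimises the value at [A]. *)
have [i pi] := psup A (e / 2) e2; have [j pj] := psup (- A) (e / 2) e2.
(* From [maxn i j] on, both points are among those used for [Cn n]. *)
have [N mN kN] := half_small (k * 2^-1) (maxn i j) e2.
exists N => // n /= Nn.
have [_ _ pos _ [near near_p]] := CnP n.
have kn : k * (2 * kap n) <= e / 2.
  apply: le_trans (ltW kN); rewrite /kap -mulrA ler_pM2l//.
  have -> : 2 * (4^-1 * 2^-1 ^+ n) = 2^-1 * 2^-1 ^+ n :> R by field.
  by rewrite ler_pM2l ?invr_gt0// ler_wiXn2l ?invr_ge0// invf_le1 ?ler1n.
have gauge t q : in_dual t -> in_dual q ->
    (forall x, W x -> `|t x - q x| <= 2 * kap n) -> `|t A - q A| <= e / 2.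
  move=> dt dq tq; apply: le_trans kn; have [L _] := dualB dt dq.
  exact: (hk (fun x => t x - q x)).
split=> [t Ct|t Ct].
  have [q Cq tq] := near t Ct; exists q => //.
  have [dt _] := pos t Ct; have [dq _] := CinU q Cq.
  by apply: le_trans (gauge _ _ dt dq tq) _; lra.
have [i_n j_n] : (i < n.+1)%N /\ (j < n.+1)%N.
  by rewrite !ltnS; split; apply: leq_trans Nn; apply: leq_trans mN; rewrite ?leq_maxl ?leq_maxr.
have [dpi _] := CinU _ (pC i); have [dpj _] := CinU _ (pC j); have [dt _] := CinU _ Ct.
have lj : p j A <= t A + e / 2.
  have := pj t Ct; have [L _] := dpj; have [L' _] := dt.
  by rewrite (linfN L) (linfN L'); lra.
(* Half of [e] goes to interpolation, the other half to the distance from [Cn n]. *)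
have [l l01 lt_] := interpolate (ltW e2) (pi t Ct) lj.
have [u Cu uq] := near_p i j l i_n j_n l01; exists u => //.
have [du _] := pos u Cu.
have dq : in_dual (fun x => l * p i x + (1 - l) * p j x) by apply: dualD; exact: dualZ.
have := gauge _ _ du dq uq.
have := ler_normD (u A - (l * p i A + (1 - l) * p j A)) (l * p i A + (1 - l) * p j A - t A).
by rewrite subrKA; lra.
Qed.
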